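(* Let $\gamma>0$, let $W$ be a standard Brownian motion and let $\xi$ be a random variable independent of $W$ whose law has support that is a subset of $[0,\infty)$ containing $0$. Then there exists at most one continuous function $b:[0,\infty)\to\mathbb{R}$ such that the solution $(\tilde X,L)$ of the Skorokhod problem for $\xi+W-b$ satisfies $\mathbb{E}[L_t]=\gamma t$ for all $t\geq0$.
   Context: **Skorokhod problem.** For a càdlàg function $f:[0,\infty)\to\mathbb{R}$ with $f_0\geq0$, a pair $(x,z)$ of càdlàg functions solves the Skorokhod problem for $f$ if $z$ is nondecreasing with $z_0=0$, $x_t = f_t+z_t\geq0$ and $\int_0^t \mathbf{1}_{\{x_s>0\}}\,\mathrm{d}z_s=0$ for all $t\geq0$. The unique solution is $z_t=\sup_{0\leq s\leq t}(f_s)_-$, $x=f+z$, where $(y)_-=\max(-y,0)$. For processes it is solved pathwise; in particular, the property required of $b$ includes $\xi-b_0\geq0$ a.s. *)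

(* Defs.v *)
From HB Require Import structures.
From mathcomp Require Import all_boot all_order all_algebra.
From mathcomp Require Import all_classical all_reals all_analysis.

Set Implicit Arguments.
Unset Strict Implicit.
Unset Printing Implicit Defensive.

Import Order.TTheory GRing.Theory Num.Theory.
Import numFieldNormedType.Exports.

Local Open Scope classical_set_scope.
Local Open Scope ring_scope.

(* A function on [0, oo) is represented by a function on R whose values at
   negative arguments are never used. *)

Section deterministic.
Context {R : realType}.
Implicit Types f x z : R -> R.

Definition cadlag f : Prop :=
  (forall t, 0 <= t -> f @ t^'+ --> f t) /\
  (forall t, 0 < t -> cvg (f @ t^'-)).

(* The measure dz is the Lebesgue-Stieltjes measure of the extension Z of z by
   0 to the negative half-line. As z 0 = 0, this measure has no atom at 0, so
   integrating over [0, t] or ]0, t] makes no difference. *)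
Record skorokhod_solution f x z : Prop := SkorokhodSolution {
  skorokhod_input_cadlag : cadlag f;
  skorokhod_input_ge0 : 0 <= f 0;
  skorokhod_x_cadlag : cadlag x;
  skorokhod_z_cadlag : cadlag z;
  skorokhod_z_nondecreasing : forall s t, 0 <= s -> s <= t -> z s <= z t;
  skorokhod_z_0 : z 0 = 0;
  skorokhod_decomposition : forall t, 0 <= t -> x t = f t + z t;
  skorokhod_x_ge0 : forall t, 0 <= t -> 0 <= x t;
  skorokhod_flat : exists Z : cumulative R R,
    (forall t, Z t = if t < 0 then 0 else z t) /\
    forall t, 0 <= t ->
      (\int[lebesgue_stieltjes_measure Z]_(s in `[0%R, t])
         (\1_[set u | (0 < x u)%R] s)%:E = 0)%E }.

Definition measure_support (mu : set R -> \bar R) : set R :=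
  [set x | forall U : set R, open U -> U x -> (0 < mu U)%E].

End deterministic.

Section stochastic.
Context {d : measure_display} {T : measurableType d} {R : realType}
  (P : probability T R).

(* Taking some of the B i equal to setT gives the product rule for every
   subfamily. *)
Definition mutually_independent (I : finType) (X : I -> T -> R) : Prop :=
  forall B : I -> set R, (forall i, measurable (B i)) ->
    (P (\bigcap_(i in [set: I]) (X i @^-1` B i)) =
     \prod_(i : I) P (X i @^-1` B i))%E.

Definition independent_increments (W : R -> T -> R) : Prop :=
  forall (n : nat) (t : nat -> R),
    0 <= t 0%N -> {homo t : i j / (i <= j)%N >-> i <= j} ->
    mutually_independent (fun (i : 'I_n) w => W (t i.+1) w - W (t i) w).

(* The second parameter of normal_prob is the standard deviation. *)
Record standard_brownian_motion (W : R -> {RV P >-> R}) : Prop :=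
  StandardBrownianMotion {
  brownian_0 : {ae P, forall w, W 0 w = 0};
  brownian_increments_independent :
    independent_increments (fun t => W t : T -> R);
  brownian_increments_gaussian : forall s t, 0 <= s -> s < t ->
    forall A : set R, measurable A ->
      P ((fun w => W t w - W s w) @^-1` A) = normal_prob 0 (Num.sqrt (t - s)) A;
  brownian_continuous :
    {ae P, forall w, {within `[0, +oo[, continuous (fun t => W t w)}} }.

Definition sigma_of_process (W : R -> T -> R) : set (set T) :=
  <<s [set E | exists t (B : set R),
         [/\ 0 <= t, measurable B & E = W t @^-1` B] ] >>.

Definition independent_of_process (xi : T -> R) (W : R -> T -> R) : Prop :=
  forall (B : set R) (E : set T), measurable B -> sigma_of_process W E ->
    (P ((xi @^-1` B) `&` E) = P (xi @^-1` B) * P E)%E.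

Definition linear_expected_regulator (gamma : R) (W : R -> {RV P >-> R})
    (xi : {RV P >-> R}) (b : R -> R) : Prop :=
  exists X L : R -> {RV P >-> R},
    {ae P, forall w, skorokhod_solution (fun t => xi w + W t w - b t)
                       (fun t => X t w) (fun t => L t w)} /\
    forall t, 0 <= t -> ('E_P[L t] = (gamma * t)%R%:E)%E.

End stochastic.

(* Main.v *)
Require Import Defs.
From HB Require Import structures.
From mathcomp Require Import all_boot all_order all_algebra.
From mathcomp Require Import all_classical all_reals all_analysis.
From mathcomp Require Import measurable_realfun lra.

Set Implicit Arguments.
Unset Strict Implicit.
Unset Printing Implicit Defensive.

Import Order.TTheory GRing.Theory Num.Theory.
Import numFieldNormedType.Exports.

Local Open Scope classical_set_scope.
Local Open Scope ring_scope.

(** For a barrier [b] with regulator [L_t = sup_(s <= t) (b_s - xi - W_s)^+],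
    put [g(t, y) = E max(y - xi - W_t, L_t)]. As [b_t - xi - W_t <= L_t],
    the function [g] equals [E L_t = gamma t] for [y <= b_t],
    and it is the value function of an optimal stopping problem for the
    time-reversed Brownian motion whose payoff involves [b] only through
    [gamma t]; hence [g] is the same for any two admissible barriers.

    In discrete time this is elementary: if the supremum is taken over the points
    of a grid, then [g_(k+1) = max(A g_k, q_(k+1))], where [q_k] is the
    expectation of the discrete regulator at step [k] and [A] averages over the
    law of an increment of [W]. Both operations are monotone and nonexpansive,
    and [q_k] is close to [gamma t_k] on a fine grid, so that the functions [g_k]
    of two barriers [b1] and [b2] are close to each other.

    Evaluating at [y = b2_t] yields [E (b2_t - xi - W_t - L1_t)^+ = 0], i.e.
    [X1_t >= b2_t - b1_t] almost surely. If [b1 < b2] at some time, then [X1]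
    is positive on a whole interval, on which [L1] is constant, contradicting
    [E L1_t = gamma t] with [gamma > 0]. *)

(** * The Skorokhod problem *)

Section skorokhod.
Context {R : realType}.
Implicit Types (f x z : R -> R) (a b t u m : R).

Lemma lebesgue_stieltjes_measure_itv_oc (Z : cumulative R R) (a b : R) :
  a <= b -> lebesgue_stieltjes_measure Z `]a, b] = (Z b - Z a)%:E.
Proof.
move=> ab; rewrite /lebesgue_stieltjes_measure /measure_extension/=.
rewrite measurable_mu_extE/=; last exact: is_ocitv.
by rewrite wlength_itv_bnd.
Qed.

(* No measurability of [A] is assumed: for a nonnegative integrand the
   integral is a supremum over simple functions. *)
Lemma integral_indic_ge_measure d (T : measurableType d)
    (mu : {measure set T -> \bar R}) (D A B : set T) :
  measurable B -> B `<=` D -> B `<=` A ->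
  (mu B <= \int[mu]_(s in D) (\1_A s)%:E)%E.
Proof.
move=> mB BD BA; rewrite integral_mkcond ge0_integralTE; last first.
  by move=> y; apply: erestrict_ge0 => s _; rewrite lee_fin.
apply: ereal_sup_ubound; exists (indic_nnsfun R mB) => /=.
  move=> s; rewrite patchE; case: (boolP (s \in B)) => sB.
    have := sB; rewrite inE => sB'.
    by rewrite (mem_set (BD _ sB')) lee_fin mindicE sB indicE (mem_set (BA _ sB')).
  by rewrite mindicE (negbTE sB); case: ifPn => //; rewrite lee_fin.
exact: sintegral_indic.
Qed.

(** Flatness in the form used below. Passing to measurable subsets of [{x > 0}] avoids having to
    show that [{x > 0}] itself is measurable. *)
Lemma skorokhod_flat_measure f x z : skorokhod_solution f x z ->
  exists Z : cumulative R R,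
    (forall t, Z t = if t < 0 then 0 else z t) /\
    forall (B : set R) t, 0 <= t -> measurable B -> B `<=` `[0, t] ->
      (forall u, B u -> 0 < x u) -> lebesgue_stieltjes_measure Z B = 0.
Proof.
move=> sol; have [Z [ZE Zflat]] := skorokhod_flat sol.
exists Z; split => // B t t0 mB Bt Bx.
apply/eqP; rewrite eq_le measure_ge0 andbT -(Zflat t t0).
exact: integral_indic_ge_measure.
Qed.

(** The increment [z b - z a] is the measure of []a, b]], so [x a] may vanish. *)
Lemma skorokhod_regulator_const f x z a b : skorokhod_solution f x z ->
  0 <= a -> a <= b -> (forall u, a < u <= b -> 0 < x u) -> z b = z a.
Proof.
move=> sol a0 ab xpos; have [Z [ZE Z0]] := skorokhod_flat_measure sol.
have b0 : 0 <= b by exact: le_trans ab.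
have : lebesgue_stieltjes_measure Z `]a, b] = 0.
  apply: (Z0 _ b) => // u /=; rewrite !in_itv/=.
  by case/andP=> au ->; rewrite (ltW (le_lt_trans a0 au)).
rewrite lebesgue_stieltjes_measure_itv_oc// !ZE !ltNge a0 b0/= => -[] /eqP.
by rewrite subr_eq0 => /eqP.
Qed.

(** Here [[a, b]] is null including its left end, which rules out a jump of [z] at [a]. Its measure
    is the limit of those of []a - 1/(n+1), b]], each at least [z b - m]. *)
Lemma skorokhod_regulator_left f x z a b m : skorokhod_solution f x z ->
  0 < a -> a <= b -> (forall u, a <= u <= b -> 0 < x u) ->
  (forall u, 0 <= u -> u < a -> z u <= m) -> z b <= m.
Proof.
move=> sol a0 ab xpos zm; have [Z [ZE Z0]] := skorokhod_flat_measure sol.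
have b0 : 0 <= b by apply: le_trans ab; exact: ltW.
have Zab : lebesgue_stieltjes_measure Z `[a, b] = 0.
  apply: (Z0 _ b) => // u /=; rewrite !in_itv/=.
  by case/andP=> au ->; rewrite (le_trans (ltW a0) au).
pose F (n : nat) : set R := `]a - n.+1%:R^-1, b]%classic.
have mleZ n : ((z b - m)%:E <= lebesgue_stieltjes_measure Z (F n))%E.
  have an : a - n.+1%:R^-1 < a by rewrite gtrBl invr_gt0.
  rewrite lebesgue_stieltjes_measure_itv_oc; last by rewrite (le_trans (ltW an)).
  (* At a negative left end [Z] is 0 by convention, that is [z 0], which is at most [m] since
     [0 < a]. *)
  rewrite lee_fin !ZE ltNge b0/= lerB//; case: ltP => // aN; last exact: zm.
  by rewrite -(skorokhod_z_0 sol); apply: zm.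
have capF : \bigcap_n F n = `[a, b]%classic.
  apply/seteqP; split=> u /=.
    move=> ab_u; have : `[a, +oo[%classic u.
      rewrite itvcyEbigcap => n _ /=; have := ab_u n I.
      by rewrite /F/= !in_itv/= andbT => /andP[].
    have := ab_u 0 I; rewrite /F/= !in_itv/= andbT => /andP[_ ub] au.
    by rewrite au.
  rewrite in_itv/= => /andP[au ub] n _; rewrite /F/= in_itv/= ub andbT.
  by rewrite (lt_le_trans _ au)// gtrBl invr_gt0.
have : lebesgue_stieltjes_measure Z \o F @ \oo -->
    lebesgue_stieltjes_measure Z (\bigcap_n F n).
  apply: nonincreasing_cvg_mu => //.
  - rewrite [X in (X < _)%E]lebesgue_stieltjes_measure_itv_oc ?ltry//.
    by rewrite (le_trans _ ab)// gerBl invr_ge0.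
  - by move=> n; exact: measurable_itv.
  - by rewrite capF; exact: measurable_itv.
  - move=> p q pq; apply/subsetPset => u; rewrite /F/= !in_itv/= => /andP[+ ->].
    rewrite andbT; apply: le_lt_trans; rewrite lerD2l lerN2 lef_pV2 ?posrE//.
    by rewrite ler_nat.
rewrite capF Zab => Z_to0.
have : ((z b - m)%:E <= 0)%E.
  by rewrite -(cvg_lim _ Z_to0)//; apply: lime_ge; [exact: cvgP Z_to0|exact: nearW].
by rewrite lee_fin subr_le0.
Qed.

Lemma skorokhod_regulator_ge f x z t u : skorokhod_solution f x z ->
  0 <= u -> u <= t -> - f u <= z t.
Proof.
move=> sol u0 ut; apply: le_trans (skorokhod_z_nondecreasing sol u0 ut).
by rewrite -subr_ge0 opprK addrC -(skorokhod_decomposition sol u0) (skorokhod_x_ge0 sol).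
Qed.

Lemma skorokhod_regulator_ge0 f x z t : skorokhod_solution f x z ->
  0 <= t -> 0 <= z t.
Proof.
by move=> sol t0; rewrite -(skorokhod_z_0 sol) (skorokhod_z_nondecreasing sol).
Qed.

(* Otherwise let [s] be the infimum of the times at which [z] exceeds [m]. On
   [s, t] the path [x] is positive, so that [z] does not increase there, and
   in particular does not jump at [s]. *)
Lemma skorokhod_regulator_le f x z t m : skorokhod_solution f x z ->
  0 <= t -> 0 <= m -> (forall u, 0 <= u -> u <= t -> - f u <= m) -> z t <= m.
Proof.
move=> sol t0 m0 fm; rewrite leNgt; apply/negP => mzt.
pose A := [set u | 0 <= u <= t /\ m < z u].
have At : A t by rewrite /A/= t0 lexx.
have A_lb : lbound A 0 by move=> u [/andP[]].
have hA : has_inf A by split; [exists t|exists 0].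
pose s := inf A.
have s0 : 0 <= s by apply: lb_le_inf => //; exists t.
have st : s <= t by apply: ge_inf => //; exists 0.
have x_pos u : 0 <= u -> u <= t -> m < z u -> 0 < x u.
  move=> u0 ut mu; rewrite (skorokhod_decomposition sol u0).
  by have := fm _ u0 ut; lra.
have z_gt u : s < u -> u <= t -> m < z u.
  move=> su ut; have [v [/andP[v0 vt] mv] vu] := inf_lt hA.1 su.
  by apply: (lt_le_trans mv); apply: (skorokhod_z_nondecreasing sol) => //; exact: ltW.
have z_const u : s < u -> u <= t -> z u = z t.
  move=> su ut; apply/esym; apply: (skorokhod_regulator_const sol) => //.
    by rewrite (le_trans s0)// ltW.
  move=> v /andP[uv vt]; apply: x_pos => //; last by apply: z_gt => //; exact: lt_trans uv.
  by rewrite (le_trans s0)// ltW// (lt_trans su).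
(* Right-continuity extends the constancy of [z] on []s, t]] to [s] itself. *)
have zs : z s = z t.
  have [->//|st'] := eqVneq s t.
  have {st'} st' : s < t by rewrite lt_neqAle st' st.
  have zc := (skorokhod_z_cadlag sol).1 _ s0.
  have zc' : z @ s^'+ --> z t.
    apply: cvg_near_cst; near=> u; apply: z_const; near: u.
      exact: nbhs_right_gt.
    exact: nbhs_right_le.
  exact: (cvg_unique _ zc zc').
have s_gt0 : 0 < s.
  rewrite lt_neqAle s0 andbT; apply/eqP => s_eq0.
  by move: mzt; rewrite -zs -s_eq0 (skorokhod_z_0 sol) ltNge m0.
suff : z t <= m by rewrite leNgt mzt.
apply: (skorokhod_regulator_left sol s_gt0 st) => [u /andP[su ut]|u u0 us].
  apply: x_pos => //; first exact: le_trans su.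
  have [<-|us] := eqVneq s u; first by rewrite zs.
  by apply: z_gt => //; rewrite lt_neqAle us.
rewrite leNgt; apply/negP => mu.
have : A u by rewrite /A/= u0 (le_trans (ltW us) st).
by move=> /(ge_inf (ex_intro _ 0 A_lb)); rewrite leNgt us.
Unshelve. all: by end_near. Qed.

End skorokhod.

(** * Independence of increments and history *)

Section independence.
Context {d : measure_display} {T : measurableType d} {R : realType}
  (P : probability T R).

(** Both sides are finite measures in [E] that agree on the pi-system [G], hence on the
    sigma-algebra it generates. *)
Lemma probability_indep_g_sigma_algebra (G : set (set T)) (D : set T) :
  G `<=` measurable -> setI_closed G -> G setT -> measurable D ->
  (forall E, G E -> P (E `&` D) = (P E * P D)%E) ->
  forall E, <<s G >> E -> P (E `&` D) = (P E * P D)%E.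
Proof.
move=> Gm GI GT mD GD E sE.
have PD0 : 0 <= fine (P D) by rewrite fine_ge0.
transitivity (mscale (NngNum PD0) P E); last first.
  by rewrite /mscale/= fineK ?fin_num_measure// muleC.
rewrite -[LHS]/(mrestr P mD E).
apply: (@g_sigma_algebra_measure_unique _ _ _ G Gm (fun=> setT)) => //.
- by rewrite bigcup_const//; exists 0%N.
- move=> A GA; change (P (A `&` D) = (fine (P D))%:E * P A)%E.
  by rewrite GD// fineK ?fin_num_measure// muleC.
- by move=> _; change (P (setT `&` D) < +oo)%E; rewrite setTI (le_lt_trans (probability_le1 P mD))// ltry.
Qed.

(** Independence makes the joint law the product of the marginal laws; Tonelli then integrates out
    [Z] first. *)
Lemma integral_indep_pair d1 d2 (T1 : measurableType d1) (T2 : measurableType d2)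
    (X : {RV P >-> T1}) (Z : {RV P >-> T2}) (f : T1 * T2 -> \bar R) :
  (forall A B, measurable A -> measurable B ->
    P (X @^-1` A `&` Z @^-1` B) = (P (X @^-1` A) * P (Z @^-1` B))%E) ->
  measurable_fun [set: T1 * T2] f -> (forall p, 0 <= f p)%E ->
  (\int[P]_w f (X w, Z w) = \int[distribution P X]_x \int[P]_w f (x, Z w))%E.
Proof.
move=> XZ_indep mf f0.
have mXZ : measurable_fun setT (fun w => (X w, Z w)) by exact: measurable_fun_pair.
pose XZ : {mfun T >-> (T1 * T2)%type} :=
  HB.pack (fun w => (X w, Z w)) (isMeasurableFun.Build _ _ _ _ _ mXZ).
transitivity (\int[distribution P XZ]_p f p)%E.
  by rewrite ge0_integral_distribution.
transitivity (\int[distribution P X \x distribution P Z]_p f p)%E.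
  apply: eq_measure_integral => A mA _; apply/esym.
  by apply: product_measure_unique => // B C mB mC; exact: XZ_indep.
rewrite fubini_tonelli1//; apply: eq_integral => x _.
rewrite /fubini_F ge0_integral_distribution//.
exact: measurableT_comp.
Qed.

End independence.

Section grid.
Context {d : measure_display} {T : measurableType d} {R : realType}
  {P : probability T R} (W : R -> {RV P >-> R}) (xi : {RV P >-> R}).
Context (W_indep : independent_increments P (fun t => W t : T -> R))
  (xi_indep : independent_of_process P xi (fun t => W t : T -> R)).
Context (t : nat -> R) (t_ge0 : 0 <= t 0%N)
  (t_homo : {homo t : i j / (i <= j)%N >-> i <= j}).

Definition grid_increment k : {RV P >-> R} := W (t k.+1) \- W (t k).

Local Notation I_ := grid_increment.

Definition increments_event k (C : nat -> set R) : set T :=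
  \bigcap_(i in [set: 'I_k]) (I_ i @^-1` C i).

(** A pi-system generating the sigma-algebra of [xi] and the first [k] increments; on such
    rectangles independence can be read off from the assumptions. *)
Definition history k : set (set T) :=
  [set E | exists (B : set R) (C : nat -> set R),
    [/\ measurable B, forall i, measurable (C i) &
        E = xi @^-1` B `&` increments_event k C] ].

Lemma increments_eventP k C w :
  increments_event k C w <-> forall i, (i < k)%N -> C i (I_ i w).
Proof.
split=> [Cw i ik|Cw i _]; last by apply: Cw; exact: ltn_ord.
exact: (Cw (Ordinal ik)).
Qed.

Lemma grid_ge0 k : 0 <= t k.
Proof. exact: le_trans (t_homo (leq0n k)). Qed.

Lemma measurable_preimage_RV (X : {RV P >-> R}) (B : set R) :
  measurable B -> measurable (X @^-1` B).
Proof. by move=> mB; exact: measurable_funPTI. Qed.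

Lemma history_measurable k : history k `<=` measurable.
Proof.
move=> _ [B [C [mB mC ->]]]; apply: measurableI; first exact: measurable_preimage_RV.
by apply: fin_bigcap_measurable => // i _; exact: measurable_preimage_RV.
Qed.

Lemma history_setI k : setI_closed (history k).
Proof.
move=> _ _ [B [C [mB mC ->]]] [B' [C' [mB' mC' ->]]].
exists (B `&` B'), (fun i => C i `&` C' i); split; first exact: measurableI.
  by move=> i; exact: measurableI.
apply/seteqP; split=> w.
  move=> [[Bw Cw] [Bw' Cw']]; split => // i _; split; [exact: Cw|exact: Cw'].
by move=> [[Bw Bw'] Cw]; split; split => // i _; have [] := Cw i I.
Qed.

Lemma history_setT k : history k setT.
Proof.
exists setT, (fun=> setT); split => //.
by apply/seteqP; split.
Qed.

Lemma sigma_of_process_measurable (s : R) : 0 <= s ->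
  @measurable_fun _ _ (g_sigma_algebraType
     [set E | exists r (B : set R), [/\ 0 <= r, measurable B & E = W r @^-1` B] ]) R
     setT (W s).
Proof.
move=> s0 _ B mB; rewrite setTI; apply: sub_sigma_algebra.
by exists s, B.
Qed.

Lemma sigma_of_process_increments_event k C : (forall i, measurable (C i)) ->
  sigma_of_process (fun t => W t : T -> R) (increments_event k C).
Proof.
move=> mC; set G := [set E | exists r (B : set R),
  [/\ 0 <= r, measurable B & E = W r @^-1` B] ].
apply: (@fin_bigcap_measurable _ (g_sigma_algebraType G)) => // i _.
rewrite -[X in measurable X]setTI.
have : @measurable_fun _ _ (g_sigma_algebraType G) R setT (I_ i).
  by apply: measurable_funB; apply: sigma_of_process_measurable; exact: grid_ge0.
by apply => //; exact: mC.
Qed.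

Lemma increments_event_indep k C D : (forall i, measurable (C i)) ->
  measurable D ->
  P (increments_event k C `&` I_ k @^-1` D) =
  (P (increments_event k C) * P (I_ k @^-1` D))%E.
Proof.
(* [C'] puts [D] in position [k], so that the product rules for [k + 1] and for [k] increments can
   be compared. *)
move=> mC mD; pose C' i := if (i < k)%N then C i else D.
have mC' i : measurable (C' i) by rewrite /C'; case: ifP.
have -> : increments_event k C `&` I_ k @^-1` D = increments_event k.+1 C'.
  apply/seteqP; split => w.
    move=> [/increments_eventP Cw Dw]; apply/increments_eventP => i.
    rewrite ltnS leq_eqVlt /C' => /predU1P[->|ik]; first by rewrite ltnn.
    by rewrite ik; exact: Cw.
  move/increments_eventP => Cw; split.
    apply/increments_eventP => i ik; have := Cw i (leqW ik).
    by rewrite /C' ik.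
  by have := Cw k (leqnn _); rewrite /C' ltnn.
rewrite (W_indep t_ge0 t_homo (fun i : 'I_k.+1 => mC' i)).
rewrite (W_indep t_ge0 t_homo (fun i : 'I_k => mC i)).
rewrite big_ord_recr/= /C' ltnn; congr (_ * _)%E.
by apply: eq_bigr => i _; rewrite ltn_ord.
Qed.

(** On a rectangle, independence of [xi] and [W] splits off the factor of [xi], and independence of
    the increments does the rest. *)
Lemma history_indep k E D : <<s history k>> E -> measurable D ->
  P (E `&` I_ k @^-1` D) = (P E * P (I_ k @^-1` D))%E.
Proof.
move=> HE mD.
apply: (probability_indep_g_sigma_algebra (@history_measurable k) (@history_setI k)
  (history_setT k)) => //; first exact: measurable_preimage_RV.
move=> _ [B [C [mB mC ->]]].
rewrite -setIA !xi_indep//.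
- by rewrite increments_event_indep// muleA.
- exact: sigma_of_process_increments_event.
(* Written as an increments event, the condition on the increment [k] lies in the sigma-algebra of
   [W]. *)
- have -> : increments_event k C `&` I_ k @^-1` D =
     increments_event k C `&` increments_event k.+1 (fun i => if i == k then D else setT).
    apply/seteqP; split => w [Cw Dw]; split => //.
      by apply/increments_eventP => i _; case: eqP => // ->.
    by move/increments_eventP : Dw => /(_ k (leqnn _)); rewrite eqxx.
  apply: (@measurableI _ (g_sigma_algebraType _)); apply: sigma_of_process_increments_event => //.
  by move=> i; case: ifP.
Qed.

End grid.

(** * The regulator on a grid *)

Section grid_regulator.
Context {d : measure_display} {T : measurableType d} {R : realType}
  {P : probability T R} (W : R -> {RV P >-> R}) (xi : {RV P >-> R}).
Context (t : nat -> R).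

(** Subtracting [W (t 0)] makes the path exactly a sum of increments, hence measurable for the
    history; [W 0] vanishes only almost surely. *)
Definition grid_path k : {RV P >-> R} := W (t k) \- W (t 0%N).

Fixpoint grid_regulator (b : R -> R) k : T -> R :=
  if k is k'.+1 then
    fun w => Num.max (grid_regulator b k' w) (b (t k) - xi w - grid_path k w)
  else fun w => Num.max 0 (b (t 0%N) - xi w).

Definition grid_value (b : R -> R) k (y : R) : \bar R :=
  (\int[P]_w (Num.max (y - xi w - grid_path k w) (grid_regulator b k w))%:E)%E.

Implicit Type b : R -> R.

Lemma grid_regulator_ge0 b k w : 0 <= grid_regulator b k w.
Proof. by elim: k => [|k IH] /=; rewrite le_max ?lexx// IH. Qed.

Lemma grid_regulator_nondecreasing b w :
  {homo grid_regulator b ^~ w : i j / (i <= j)%N >-> i <= j}.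
Proof.
apply: homo_leq => // [x y z|k]; first exact: le_trans.
by rewrite /= le_max lexx.
Qed.

Lemma grid_regulator_ge b k w : b (t k) - xi w - grid_path k w <= grid_regulator b k w.
Proof.
case: k => [|k] /=; first by rewrite subrr subr0 le_max lexx orbT.
by rewrite le_max lexx orbT.
Qed.

Lemma grid_regulator_le b k w m : 0 <= m ->
  (forall j, (j <= k)%N -> b (t j) - xi w - grid_path j w <= m) ->
  grid_regulator b k w <= m.
Proof.
move=> m0; elim: k => [|k IH] bm /=; rewrite ge_max.
  by rewrite m0; have := bm 0%N isT; rewrite /= subrr subr0.
by rewrite bm// andbT IH// => j jk; exact/bm/leqW.
Qed.

Lemma measurable_history_xi k :
  @measurable_fun _ _ (g_sigma_algebraType (history W xi t k)) R setT xi.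
Proof.
move=> _ B mB; rewrite setTI; apply: sub_sigma_algebra.
exists B, (fun=> setT); split => //.
by apply/seteqP; split => [w Bw|w []//]; split.
Qed.

Lemma measurable_history_increment k i : (i < k)%N ->
  @measurable_fun _ _ (g_sigma_algebraType (history W xi t k)) R setT
    (grid_increment W t i).
Proof.
move=> ik _ B mB; rewrite setTI; apply: sub_sigma_algebra.
exists setT, (fun j => if j == i then B else setT); split => //.
  by move=> j; case: ifP.
rewrite preimage_setT setTI; apply/seteqP; split => w.
  by move=> Bw; apply/increments_eventP => j _; case: eqP => // ->.
by move/increments_eventP => /(_ i ik); rewrite eqxx.
Qed.

Lemma grid_pathS k w : grid_path k.+1 w = grid_path k w + grid_increment W t k w.
Proof. by rewrite /=; lra. Qed.

Lemma measurable_history_path k j : (j <= k)%N ->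
  @measurable_fun _ _ (g_sigma_algebraType (history W xi t k)) R setT (grid_path j).
Proof.
elim: j => [|j IH] jk.
  have -> : (grid_path 0 : T -> R) = cst 0 by apply/funext => w; rewrite /= subrr.
  exact: measurable_cst.
have -> : (grid_path j.+1 : T -> R) = fun w => grid_path j w + grid_increment W t j w.
  by apply/funext => w; rewrite grid_pathS.
by apply: measurable_funD; [exact: (IH (ltnW jk))|exact: measurable_history_increment].
Qed.

Lemma measurable_history_regulator b k j : (j <= k)%N ->
  @measurable_fun _ _ (g_sigma_algebraType (history W xi t k)) R setT (grid_regulator b j).
Proof.
elim: j => [|j IH] jk /=.
  apply: measurable_maxr; first exact: measurable_cst.
  by apply: measurable_funB; [exact: measurable_cst|exact: measurable_history_xi].
apply: measurable_maxr; first exact: (IH (ltnW jk)).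
apply: measurable_funB; last exact: measurable_history_path.
by apply: measurable_funB; [exact: measurable_cst|exact: measurable_history_xi].
Qed.

Lemma measurable_grid_regulator b k : measurable_fun setT (grid_regulator b k).
Proof.
elim: k => [|k IH] /=.
  by apply: measurable_maxr => //; exact: measurable_funB.
by apply: measurable_maxr => //; do 2 apply: measurable_funB => //.
Qed.

Lemma measurable_grid_value b k y : measurable_fun setT (fun w =>
  (Num.max (y - xi w - grid_path k w) (grid_regulator b k w))%:E).
Proof.
apply/measurable_EFinP/measurable_maxr; last exact: measurable_grid_regulator.
by do 2 apply: measurable_funB => //.
Qed.

Context (W_indep : independent_increments P (fun t => W t : T -> R))
  (xi_indep : independent_of_process P xi (fun t => W t : T -> R))
  (t_ge0 : 0 <= t 0%N) (t_homo : {homo t : i j / (i <= j)%N >-> i <= j}).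

(** The two terms containing the new increment combine into
    [max(y, b (t k.+1)) - xi - grid_path k.+1], and this increment is independent of [xi], the path
    and the regulator up to step [k]. *)
Lemma grid_valueS b k y : grid_value b k.+1 y =
  (\int[distribution P (grid_increment W t k)]_x
     grid_value b k (Num.max y (b (t k.+1)) - x))%E.
Proof.
set c := Num.max y (b (t k.+1)).
have mUV : measurable_fun setT (fun w => (xi w + grid_path k w, grid_regulator b k w)).
  apply: measurable_fun_pair; last exact: measurable_grid_regulator.
  exact: measurable_funD.
pose UV : {RV P >-> (R * R)%type} := HB.pack
  (fun w => (xi w + grid_path k w, grid_regulator b k w))
  (isMeasurableFun.Build _ _ _ _ _ mUV).
(* The maximum with 0 makes [f] nonnegative everywhere, as Tonelli requires; it changes nothing at
   the values taken, the regulator being nonnegative. *)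
pose f (p : R * (R * R)) : \bar R :=
  (Num.max 0 (Num.max (c - p.1 - p.2.1) p.2.2))%:E.
have UV_indep A B : measurable A -> measurable B ->
    P (grid_increment W t k @^-1` A `&` UV @^-1` B) =
    (P (grid_increment W t k @^-1` A) * P (UV @^-1` B))%E.
  move=> mA mB; rewrite setIC muleC (history_indep W_indep xi_indep t_ge0 t_homo)//.
  have : @measurable_fun _ _ (g_sigma_algebraType (history W xi t k)) (R * R)%type
      setT UV.
    apply: measurable_fun_pair; last exact: measurable_history_regulator.
    by apply: measurable_funD; [exact: measurable_history_xi|exact: measurable_history_path].
  by move=> /(_ measurableT _ mB); rewrite setTI.
have mf : measurable_fun setT f.
  apply/measurable_EFinP; apply: measurable_maxr => //.
  apply: measurable_maxr; last exact: measurableT_comp.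
  apply: measurable_funB; last exact: measurableT_comp.
  exact: measurable_funB.
have f0 p : (0 <= f p)%E by rewrite lee_fin le_max lexx.
have := integral_indep_pair UV_indep mf f0.
rewrite (_ : (\int[P]_w f _)%E = grid_value b k.+1 y) => [->|].
  apply: eq_integral => x _; apply: eq_integral => w _; rewrite /f; congr EFin.
  rewrite /= (max_idPr _); last by rewrite le_max grid_regulator_ge0 orbT.
  by congr Num.max; rewrite opprD addrA.
apply: eq_integral => w _; congr EFin.
rewrite (max_idPr _); last by rewrite le_max grid_regulator_ge0 orbT.
rewrite [in RHS]/= [Num.max (grid_regulator _ _ _) _]maxC maxA; congr Num.max.
by rewrite /= -!addr_maxl -/c; lra.
Qed.

Lemma grid_value_nondecreasing b k y y' : y <= y' ->
  (grid_value b k y <= grid_value b k y')%E.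
Proof.
move=> yy'; apply: ge0_le_integral => //.
- by move=> w _; rewrite lee_fin le_max grid_regulator_ge0 orbT.
- exact: measurable_grid_value.
- exact: measurable_grid_value.
- by move=> w _; rewrite lee_fin ge_max !le_max lexx orbT andbT !lerD2r yy'.
Qed.

Lemma grid_value_le b k y : y <= b (t k) ->
  grid_value b k y = (\int[P]_w (grid_regulator b k w)%:E)%E.
Proof.
move=> yb; apply: eq_integral => w _; congr EFin; apply/max_idPr.
by apply: le_trans (grid_regulator_ge b k w); rewrite !lerD2r.
Qed.

Lemma grid_value_ge b k y :
  (\int[P]_w (grid_regulator b k w)%:E <= grid_value b k y)%E.
Proof.
apply: ge0_le_integral => //.
- by move=> w _; rewrite lee_fin grid_regulator_ge0.
- exact/measurable_EFinP/measurable_grid_regulator.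
- exact: measurable_grid_value.
- by move=> w _; rewrite lee_fin le_max lexx orbT.
Qed.

End grid_regulator.

(** * Comparison of the grid values of two barriers *)

Section grid_comparison.
Context {d : measure_display} {T : measurableType d} {R : realType}
  {P : probability T R} (W : R -> {RV P >-> R}) (xi : {RV P >-> R})
  (W_indep : independent_increments P (fun t => W t : T -> R))
  (xi_indep : independent_of_process P xi (fun t => W t : T -> R))
  (t : nat -> R) (t_ge0 : 0 <= t 0%N)
  (t_homo : {homo t : i j / (i <= j)%N >-> i <= j}).
Implicit Type b : R -> R.

Local Notation regulator := (grid_regulator W xi t).
Local Notation value := (grid_value W xi t).

Lemma measurable_grid_value_shift b k (c : R) :
  measurable_fun setT (fun x : R => value b k (c - x)).
Proof.
pose f (p : R * T) : \bar R :=
  (Num.max (c - p.1 - xi p.2 - grid_path W t k p.2) (regulator b k p.2))%:E.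
apply: (@measurable_fun_fubini_tonelli_F _ _ _ _ _ P f) => [|p].
  apply/measurable_EFinP; apply: measurable_maxr; last first.
    exact: (measurableT_comp (measurable_grid_regulator _ _ _ _ _)).
  apply: measurable_funB; last exact: (measurableT_comp (measurable_funPT _)).
  apply: measurable_funB; last exact: (measurableT_comp (measurable_funPT _)).
  exact: measurable_funB.
by rewrite lee_fin le_max grid_regulator_ge0 orbT.
Qed.

Lemma grid_value_ge0 b k y : (0 <= value b k y)%E.
Proof. by apply: integral_ge0 => w _; rewrite lee_fin le_max grid_regulator_ge0 orbT. Qed.

(** Induction along the recursion. Up to [b1] the value is the expected regulator, controlled
    through [q]; above [b1] the recursion averages the previous values, which preserves the error
    [e]. *)
Lemma grid_value_le_shift b1 b2 (e : R) (q : nat -> R) n : 0 <= e ->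
  (forall k, (k <= n)%N -> (\int[P]_w (regulator b1 k w)%:E <= (q k)%:E)%E) ->
  (forall k, (k <= n)%N ->
    ((q k)%:E <= \int[P]_w (regulator b2 k w)%:E + e%:E)%E) ->
  (forall y, value b1 0 y <= value b2 0 y + e%:E)%E ->
  forall k, (k <= n)%N -> forall y, (value b1 k y <= value b2 k y + e%:E)%E.
Proof.
move=> e0 le_q q_le le0; elim=> [//|k IH] kn y.
have [yb|by_] := leP y (b1 (t k.+1)).
  rewrite grid_value_le//; apply: (le_trans (le_q _ kn)).
  by apply: (le_trans (q_le _ kn)); rewrite leeD2r// grid_value_ge.
rewrite !grid_valueS// (max_idPl (ltW by_)).
apply: (@le_trans _ _ (\int[distribution P (grid_increment W t k)]_x
   (value b2 k (y - x) + e%:E))%E).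
  apply: ge0_le_integral => //.
  - by move=> x _; exact: grid_value_ge0.
  - exact: measurable_grid_value_shift.
  - apply: emeasurable_funD => //; exact: measurable_grid_value_shift.
  - by move=> x _; apply: IH; exact: ltnW.
rewrite ge0_integralD//; last 2 first.
- by move=> x _; exact: grid_value_ge0.
- exact: measurable_grid_value_shift.
rewrite integral_cst// [X in (e%:E * X)%E](_ : _ = 1%E); last exact: probability_setT.
rewrite mule1 leeD2r//.
(* For [b2] the recursion evaluates at [max(y, b2 (t k.+1))], which is at least [y], so monotonicity
   suffices wherever [y] lies relative to [b2]. *)
apply: ge0_le_integral => //.
- by move=> x _; exact: grid_value_ge0.
- exact: measurable_grid_value_shift.
- exact: measurable_grid_value_shift.
- by move=> x _; apply: grid_value_nondecreasing; rewrite lerD2r le_max lexx.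
Qed.

End grid_comparison.

(** * Refining the grid *)

Section mesh.
Context {R : realType}.

Definition mesh_grid (h : R) (j : nat) : R := j%:R * h.

Lemma mesh_grid0 h : mesh_grid h 0 = 0.
Proof. by rewrite /mesh_grid mul0r. Qed.

Lemma mesh_grid_homo h : 0 <= h ->
  {homo mesh_grid h : i j / (i <= j)%N >-> i <= j}.
Proof. by move=> h0 i j ij; rewrite ler_wpM2r// ler_nat. Qed.

Lemma mesh_grid_refine h i p : mesh_grid (h / p.+1%:R) (i * p.+1) = mesh_grid h i.
Proof. by rewrite /mesh_grid natrM -mulrA [X in _ * X]mulrC divfK// pnatr_eq0. Qed.

Lemma mesh_grid_next h (u : R) n : 0 < h -> 0 <= u -> u < mesh_grid h n ->
  exists2 j, (j <= n)%N & u < mesh_grid h j <= u + h.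
Proof.
move=> h0 u0 un; have uh0 : 0 <= u / h by rewrite divr_ge0// ltW.
exists (Num.truncn (u / h)).+1.
  by rewrite truncn_lt_nat// ltr_pdivrMr.
have /andP[lo hi] := truncn_itv uh0.
rewrite /mesh_grid -ltr_pdivrMr// hi/= -ler_pdivlMr// mulrDl divff ?gt_eqF//.
by rewrite -natr1 lerD2r.
Qed.

End mesh.

(** * Grid regulators against the solution, path by path *)

Section expected_regulator.
Context {d : measure_display} {T : measurableType d} {R : realType}
  {P : probability T R} (W : R -> {RV P >-> R}) (xi : {RV P >-> R}) (b : R -> R)
  (X L : R -> {RV P >-> R}).
Implicit Type t : nat -> R.

Definition solution_path (w : T) : Prop := W 0 w = 0 /\
  skorokhod_solution (fun r => xi w + W r w - b r) (fun r => X r w) (fun r => L r w).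

Lemma grid_regulator_le_solution t k w : t 0%N = 0 ->
  {homo t : i j / (i <= j)%N >-> i <= j} -> solution_path w ->
  grid_regulator W xi t b k w <= L (t k) w.
Proof.
move=> t0 t_homo [W0 sol].
have t_ge0 j : 0 <= t j by rewrite -t0 t_homo.
apply: grid_regulator_le => [|j jk]; first exact: (skorokhod_regulator_ge0 sol).
have := skorokhod_regulator_ge sol (t_ge0 j) (t_homo _ _ jk).
by rewrite /= t0 W0; lra.
Qed.

(** By minimality of the regulator some time [u <= s] satisfies [- f u > L s - e]; by
    right-continuity of [f] the next point of a fine grid does so too. *)
Lemma grid_regulator_ge_solution h i (e : R) w : 0 < h -> 0 < e ->
  solution_path w ->
  \forall p \near \oo, L (mesh_grid h i) w - e <=
    grid_regulator W xi (mesh_grid (h / p.+1%:R)) b (i * p.+1) w.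
Proof.
move=> h0 e0 [W0 sol]; set s := mesh_grid h i.
have s0 : 0 <= s by rewrite /s /mesh_grid mulr_ge0// ltW.
have V_ge p j : (j <= i * p.+1)%N ->
    - (xi w + W (mesh_grid (h / p.+1%:R) j) w - b (mesh_grid (h / p.+1%:R) j)) <=
    grid_regulator W xi (mesh_grid (h / p.+1%:R)) b (i * p.+1) w.
  move=> jn; apply: le_trans (grid_regulator_nondecreasing _ _ _ _ _ jn).
  apply: le_trans (grid_regulator_ge _ _ _ _ _ _).
  by rewrite /= mesh_grid0 W0; lra.
(* The minimality lemma needs a nonnegative bound, here [L s w - e]. *)
have [Le|eL] := leP (L s w) e.
  by apply: nearW => p; rewrite (@le_trans _ _ 0) ?subr_le0// grid_regulator_ge0.
have [u [u0 us fu]] : exists u, [/\ 0 <= u, u <= s &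
    L s w - e < - (xi w + W u w - b u)].
  apply: contrapT => no_u.
  have : L s w <= L s w - e; last by apply/negP; rewrite -ltNge; lra.
  apply: (skorokhod_regulator_le sol) => // [|u u0 us]; first by lra.
  by rewrite leNgt; apply/negP => fu; apply: no_u; exists u.
have [us_eq|us_neq] := eqVneq u s.
  (* No grid point up to [s] lies to the right of [u = s], but [s] belongs to every refinement. *)
  move: fu; rewrite us_eq => /ltW fs; apply: nearW => p; apply: (le_trans fs).
  by have := V_ge p _ (leqnn _); rewrite mesh_grid_refine -/s.
have {us_neq us} us : u < s by rewrite lt_neqAle us_neq.
have fcvg := (skorokhod_input_cadlag sol).1 u u0.
have : \forall v \near u^'+, xi w + W v w - b v < - (L s w - e).
  by apply: (cvgr_lt _ fcvg); rewrite ltrNr.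
case=> r /= r0 fr.
have rh0 : 0 < r / h by rewrite divr_gt0.
near=> p.
have hp0 : 0 < h / p.+1%:R by rewrite divr_gt0.
have [|j jn /andP[uj ju]] := @mesh_grid_next _ (h / p.+1%:R) u (i * p.+1) hp0 u0.
  by rewrite mesh_grid_refine.
apply: le_trans (V_ge p j jn); rewrite lerNr ltW// fr//=.
rewrite /ball/= ltr0_norm ?subr_lt0// opprB ltrBlDl (le_lt_trans ju)// ltrD2l.
have : p.+1%:R^-1 < r / h.
  by near: p; exact: (near_infty_natSinv_lt (PosNum rh0)).
by rewrite ltr_pdivlMr// mulrC.
Unshelve. all: by end_near. Qed.

End expected_regulator.

(** * Expectations of the grid regulators *)

Section expected_regulator_bounds.
Context {d : measure_display} {T : measurableType d} {R : realType}
  {P : probability T R} (W : R -> {RV P >-> R}) (xi : {RV P >-> R}) (b : R -> R)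
  (X L : R -> {RV P >-> R}) (gamma : R).
Context (sol_ae : {ae P, forall w, solution_path W xi b X L w})
  (EL : forall s : R, 0 <= s -> ('E_P[L s] = (gamma * s)%:E)%E)
  (gamma_ge0 : 0 <= gamma).
Implicit Type t : nat -> R.

(** [L s] is nonnegative only almost surely; its positive part is so everywhere, as comparison of
    integrals requires. *)
Lemma expected_regulator_pos (s : R) : 0 <= s ->
  (\int[P]_w (Num.max 0 (L s w))%:E = (gamma * s)%:E)%E.
Proof.
move=> s0; rewrite -EL// expectation_def; apply: ae_eq_integral => //.
- by apply/measurable_EFinP; exact: measurable_maxr.
- exact/measurable_EFinP.
apply: filterS sol_ae => w [_ sol] _; congr EFin; apply/max_idPr.
exact: (skorokhod_regulator_ge0 sol).
Qed.

Lemma expected_grid_regulator_le t k : t 0%N = 0 ->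
  {homo t : i j / (i <= j)%N >-> i <= j} ->
  (\int[P]_w (grid_regulator W xi t b k w)%:E <= (gamma * t k)%:E)%E.
Proof.
move=> t0 t_homo; rewrite -expected_regulator_pos; last by rewrite -t0 t_homo.
apply: ae_ge0_le_integral => //.
- by move=> w _; rewrite lee_fin grid_regulator_ge0.
- exact/measurable_EFinP/measurable_grid_regulator.
- by move=> w _; rewrite lee_fin le_max lexx.
- by apply/measurable_EFinP; exact: measurable_maxr.
apply: filterS sol_ae => w sol _; rewrite lee_fin le_max.
by rewrite (grid_regulator_le_solution _ _ _ sol) ?orbT.
Qed.

(** Dominated convergence: almost surely the refined grid regulators converge to [L] and stay below
    it, and [L] has finite expectation. *)
Lemma expected_grid_regulator_cvg (h : R) i : 0 < h ->
  (\int[P]_w (grid_regulator W xi (mesh_grid (h / p.+1%:R)) b (i * p.+1) w)%:E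
     @[p --> \oo] --> (gamma * mesh_grid h i)%:E)%E.
Proof.
move=> h0; set s := mesh_grid h i.
have s0 : 0 <= s by rewrite mulr_ge0// ltW.
have hp p : 0 <= h / p.+1%:R by rewrite divr_ge0// ltW.
pose V p w := grid_regulator W xi (mesh_grid (h / p.+1%:R)) b (i * p.+1) w.
have mL : measurable_fun setT (fun w => (Num.max 0 (L s w))%:E).
  by apply/measurable_EFinP; exact: measurable_maxr.
have VL : {ae P, forall w, forall p, V p w <= Num.max 0 (L s w)}.
  apply: filterS sol_ae => w sol p; rewrite le_max.
  have := @grid_regulator_le_solution _ _ _ _ W xi b X L (mesh_grid (h / p.+1%:R)) (i * p.+1) w.
  by rewrite mesh_grid_refine -/s => -> //; rewrite ?orbT ?mesh_grid0//; exact: mesh_grid_homo.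
have [||||| _ _ ] := @dominated_convergence _ _ _ P _ measurableT
  (fun p w => (V p w)%:E) (fun w => (Num.max 0 (L s w))%:E)
  (fun w => (Num.max 0 (L s w))%:E).
- by move=> p; exact/measurable_EFinP/measurable_grid_regulator.
- exact: mL.
- apply: filterS2 VL sol_ae => w VLw sol _.
  apply/cvg_EFin; first exact: nearW.
  apply/cvgrPdist_le => e e0.
  apply: filterS (grid_regulator_ge_solution i h0 e0 sol) => p.
  have := VLw p; rewrite -/(V p w) -/s.
  have -> : Num.max 0 (L s w) = L s w.
    by apply/max_idPr; exact: (skorokhod_regulator_ge0 sol.2).
  by move=> VLp LVp; rewrite ger0_norm ?subr_ge0//=; lra.
- apply/integrableP; split; first exact: mL.
  under eq_integral do rewrite gee0_abs ?lee_fin ?le_max ?lexx//.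
  by rewrite expected_regulator_pos// ltry.
- apply: filterS VL => w VLw p _.
  by rewrite gee0_abs lee_fin// grid_regulator_ge0.
by rewrite expected_regulator_pos.
Qed.

(** Convergence is uniform over the finitely many coarse points. A fine index [k] lies less than one
    coarse step after the coarse point [k %/ p.+1]; the regulator is monotone, so this costs at most
    [gamma * h]. *)
Lemma expected_grid_regulator_ge m (h e : R) : 0 < h -> 0 < e ->
  \forall p \near \oo, forall k, (k <= m * p.+1)%N ->
    ((gamma * mesh_grid (h / p.+1%:R) k)%:E <=
     \int[P]_w (grid_regulator W xi (mesh_grid (h / p.+1%:R)) b k w)%:E +
     (gamma * h + e)%:E)%E.
Proof.
move=> h0 e0.
have coarse : \forall p \near \oo, forall i : 'I_m.+1,
    ((gamma * mesh_grid h i - e)%:E <=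
    \int[P]_w (grid_regulator W xi (mesh_grid (h / p.+1%:R)) b (i * p.+1) w)%:E)%E.
  apply: filter_forall => i.
  have := @expected_grid_regulator_cvg h i h0.
  move=> /fine_cvgP[fin /cvgr_gt /(_ (gamma * mesh_grid h i - e))].
  rewrite ltrBlDr ltrDl e0 => /(_ isT); apply: filterS2 fin => p fin /ltW.
  by rewrite -lee_fin /= fineK.
apply: filterS coarse => p coarse k km.
have hp : 0 < h / p.+1%:R by rewrite divr_gt0.
pose i := (k %/ p.+1)%N.
have im : (i < m.+1)%N by rewrite ltnS -(mulnK m (ltn0Sn p)) leq_div2r.
have ik : (i * p.+1 <= k)%N by exact: leq_divM.
have ki : mesh_grid (h / p.+1%:R) k <= mesh_grid h i + h.
  rewrite -(mesh_grid_refine h i p) /mesh_grid.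
  have : (k%:R <= (i * p.+1)%:R + p.+1%:R :> R).
    by rewrite -natrD ler_nat -mulSnr ltnW// -ltn_divLR.
  rewrite -(ler_pM2r hp) mulrDl => /le_trans; apply.
  by rewrite lerD2l mulrC divfK// pnatr_eq0.
apply: (@le_trans _ _ ((gamma * mesh_grid h i - e) + (gamma * h + e))%:E).
  rewrite lee_fin; have := ler_wpM2l gamma_ge0 ki; lra.
rewrite EFinD leeD2r//; apply: le_trans (coarse (Ordinal im)) _.
apply: ge0_le_integral => //.
- by move=> w _; rewrite lee_fin grid_regulator_ge0.
- exact/measurable_EFinP/measurable_grid_regulator.
- exact/measurable_EFinP/measurable_grid_regulator.
- by move=> w _; rewrite lee_fin grid_regulator_nondecreasing.
Qed.

(** The Skorokhod problem requires [xi - b 0 >= 0], so the initial value is the same for all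
    admissible barriers. *)
Lemma grid_value0 t y : t 0%N = 0 ->
  grid_value W xi t b 0 y = (\int[P]_w (Num.max (y - xi w) 0)%:E)%E.
Proof.
move=> t0; apply: ae_eq_integral => //.
- exact: measurable_grid_value.
- by apply/measurable_EFinP/measurable_maxr => //; exact: measurable_funB.
apply: filterS sol_ae => w [W0 sol] _; congr EFin.
rewrite /= subrr subr0; congr Num.max; apply/max_idPl.
by have := skorokhod_input_ge0 sol; rewrite t0 W0; lra.
Qed.

End expected_regulator_bounds.

(** * Comparison of two barriers *)

Section comparison.
Context {d : measure_display} {T : measurableType d} {R : realType}
  {P : probability T R} (W : R -> {RV P >-> R}) (xi : {RV P >-> R}) (gamma : R)
  (W_indep : independent_increments P (fun t => W t : T -> R))
  (xi_indep : independent_of_process P xi (fun t => W t : T -> R))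
  (gamma_gt0 : 0 < gamma)
  (b1 b2 : R -> R) (X1 L1 X2 L2 : R -> {RV P >-> R})
  (sol1 : {ae P, forall w, solution_path W xi b1 X1 L1 w})
  (sol2 : {ae P, forall w, solution_path W xi b2 X2 L2 w})
  (EL1 : forall s : R, 0 <= s -> ('E_P[L1 s] = (gamma * s)%:E)%E)
  (EL2 : forall s : R, 0 <= s -> ('E_P[L2 s] = (gamma * s)%:E)%E).

Lemma expected_gap_le (s e : R) : 0 < s -> 0 < e ->
  (\int[P]_w (Num.max 0 (b2 s - xi w - W s w - L1 s w))%:E <= (4 * e)%:E)%E.
Proof.
(* With [m] coarse steps [gamma * h <= e], so the grid error [gamma * h + e] is at most [2 * e]. *)
move=> s0 e0; pose m := (Num.truncn (gamma * s / e)).+1.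
pose h := s / m%:R.
have m0 : 0 < m%:R :> R by rewrite ltr0n.
have h0 : 0 < h by rewrite divr_gt0.
have he : gamma * h <= e.
  rewrite /h mulrA ler_pdivrMr// [leRHS]mulrC -ler_pdivrMr// ltW//.
  by rewrite truncnS_gt.
have hm : mesh_grid h m = s by rewrite /mesh_grid /h mulrC divfK// gt_eqF.
have near1 := expected_grid_regulator_ge sol1 EL1 (ltW gamma_gt0) m h0 e0.
have near2 := expected_grid_regulator_ge sol2 EL2 (ltW gamma_gt0) m h0 e0.
have [p [/= ge1 ge2]] := filter_ex (filterI near1 near2).
set t := mesh_grid (h / p.+1%:R) in ge1 ge2; set n := (m * p.+1)%N in ge1 ge2.
have t0 : t 0%N = 0 by exact: mesh_grid0.
have t_homo : {homo t : i j / (i <= j)%N >-> i <= j}.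
  by apply: mesh_grid_homo; rewrite divr_ge0// ltW.
have tn : t n = s by rewrite /t mesh_grid_refine.
set y := b2 s; set G := (X in (X <= _)%E).
set V1 := grid_regulator W xi t b1 n.
have EV1 : (\int[P]_w (V1 w)%:E <= (gamma * s)%:E)%E.
  by rewrite -tn (expected_grid_regulator_le sol1 EL1).
have EV1_fin : (\int[P]_w (V1 w)%:E)%E \is a fin_num.
  rewrite ge0_fin_numE; first exact: le_lt_trans EV1 (ltry _).
  by apply: integral_ge0 => w _; rewrite lee_fin grid_regulator_ge0.
have mG : measurable_fun setT (fun w => (Num.max 0 (y - xi w - W s w - L1 s w))%:E).
  apply/measurable_EFinP; apply: measurable_maxr => //.
  by do 3 apply: measurable_funB => //.
have mV1 : measurable_fun setT (fun w => (V1 w)%:E).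
  exact/measurable_EFinP/measurable_grid_regulator.
(* As [V1 <= L1], adding the excess of [y - xi - W] over [L1] to [V1] stays below
   [max(y - xi - W, V1)]. *)
have VG : (\int[P]_w (V1 w)%:E + G <= grid_value W xi t b1 n y)%E.
  rewrite -ge0_integralD//; last 2 first.
  - by move=> w _; rewrite lee_fin grid_regulator_ge0.
  - by move=> w _; rewrite lee_fin le_max lexx.
  apply: ae_ge0_le_integral => //.
  - by move=> w _; rewrite -EFinD lee_fin addr_ge0 ?grid_regulator_ge0// le_max lexx.
  - exact: emeasurable_funD.
  - by move=> w _; rewrite lee_fin le_max grid_regulator_ge0 orbT.
  - exact: measurable_grid_value.
  apply: filterS sol1 => w sol _; rewrite -EFinD lee_fin -/V1 /=.
  have := grid_regulator_le_solution n t0 t_homo sol.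
  rewrite tn t0 sol.1 -/V1 subr0 => VL.
  rewrite addr_maxr ge_max le_max addr0 lexx orbT/= le_max.
  by apply/orP; left; lra.
have t0_ge0 : 0 <= t 0%N by rewrite t0.
have e_ge0 : 0 <= gamma * h + e by rewrite addr_ge0 ?ltW// mulr_gt0.
have value0 y' : (grid_value W xi t b1 0 y' <=
    grid_value W xi t b2 0 y' + (gamma * h + e)%:E)%E.
  by rewrite (grid_value0 sol1)// (grid_value0 sol2)// leeDl.
have n_shift := @grid_value_le_shift _ _ _ _ _ _ W_indep xi_indep _ t0_ge0 t_homo
  b1 b2 _ (fun k => gamma * t k) n e_ge0
  (fun k _ => expected_grid_regulator_le sol1 EL1 k t0 t_homo) ge2 value0 n (leqnn n) y.
have EV2 : (grid_value W xi t b2 n y <= (gamma * s)%:E)%E.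
  by rewrite grid_value_le ?tn// -tn (expected_grid_regulator_le sol2 EL2).
have {ge1} ge1 := ge1 n (leqnn _); rewrite tn -/V1 in ge1.
(* The finite expectation of [V1] cancels. The grid error enters twice: in passing from [b1] to
   [b2], and in replacing [gamma * s] by the expectation of [V1]. *)
have cancel (A B C : \bar R) (r : R) : A \is a fin_num -> (A + B <= C + r%:E ->
    C <= A + r%:E -> B <= (r + r)%:E)%E.
  move=> A_fin ABC CA; rewrite -(leeD2lE _ _ A_fin) EFinD addeA.
  by apply: le_trans ABC _; rewrite leeD2r.
apply: le_trans (cancel _ _ _ _ EV1_fin (le_trans VG n_shift) (le_trans EV2 ge1)) _.
by rewrite lee_fin; lra.
Qed.

(** As [e] tends to 0 the expected gap vanishes, so [b2 - xi - W <= L1] almost surely, and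
    [X1 = xi + W - b1 + L1]. *)
Lemma solution_ge_gap (s : R) : 0 < s -> {ae P, forall w, b2 s - b1 s <= X1 s w}.
Proof.
move=> s0; pose G w := Num.max 0 (b2 s - xi w - W s w - L1 s w).
have G0 w : 0 <= G w by rewrite le_max lexx.
have mG : measurable_fun setT (fun w => (G w)%:E).
  apply/measurable_EFinP; apply: measurable_maxr => //.
  by do 3 apply: measurable_funB => //.
have IG0 : (\int[P]_w `|(G w)%:E| = 0)%E.
  under eq_integral do rewrite gee0_abs ?lee_fin//.
  apply/eqP; rewrite eq_le integral_ge0 ?andbT; last by move=> w _; rewrite lee_fin.
  apply/lee_addgt0Pr => e e0; rewrite add0e.
  have e4 : 0 < e / 4 by rewrite divr_gt0.
  by rewrite (le_trans (expected_gap_le s0 e4))// lee_fin mulrC divfK.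
have := (ae_eq_integral_abs P measurableT mG).1 IG0.
apply: filterS2 sol1 => w [W0 sol] /(_ I) [Gw].
rewrite (skorokhod_decomposition sol (ltW s0)).
have : b2 s - xi w - W s w - L1 s w <= 0 by rewrite -Gw le_max lexx orbT.
by lra.
Qed.

Context (b1_continuous : {within `[0, +oo[, continuous b1})
  (b2_continuous : {within `[0, +oo[, continuous b2}).

Lemma barrier_right_continuous (b : R -> R) (v : R) :
  {within `[0, +oo[, continuous b} -> 0 <= v -> b @ v^'+ --> b v.
Proof.
move=> /continuous_within_itvcyP[b_cont b_right]; rewrite le_eqVlt.
move=> /predU1P[<-//|v0]; apply: cvg_at_right_filter.
by apply: b_cont; rewrite in_itv/= v0.
Qed.

(* If [b1 < b2] at [s], hence on an interval to the right of [s], then [X1] is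
   positive there, so that [L1] cannot increase, against [E L1_t = gamma t]. *)
Lemma barrier_le (s : R) : 0 <= s -> b2 s <= b1 s.
Proof.
move=> s0; rewrite leNgt; apply/negP => b12.
have gap_cvg v : 0 <= v -> b2 r - b1 r @[r --> v^'+] --> b2 v - b1 v.
  by move=> v0; apply: cvgB; apply: barrier_right_continuous.
have : \forall r \near s^'+, 0 < b2 r - b1 r.
  by apply: (cvgr_gt _ (gap_cvg _ s0)); rewrite subr_gt0.
case=> e /= e0 gap_pos.
have {}gap_pos r : s <= r -> r < s + e -> 0 < b2 r - b1 r.
  rewrite le_eqVlt => /predU1P[<-|sr re]; first by rewrite subr_gt0.
  by apply: gap_pos => //=; rewrite /ball/= distrC ger0_norm ?subr_ge0 ?ltW//; lra.
(* The exceptional null set depends on the time; enumerating the rationals gives a common one for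
   all positive rational times. *)
have rat_gap : {ae P, forall w, forall n, forall q : rat, unpickle n = Some q ->
    0 < ratr q :> R -> b2 (ratr q) - b1 (ratr q) <= X1 (ratr q) w}.
  apply: ae_foralln => n; case: (unpickle n) => [q|]; last by apply: aeW.
  have [q0|q0] := leP (ratr q : R) 0.
    by apply: aeW => w _ [<-]; rewrite ltNge q0.
  by apply: filterS (solution_ge_gap q0) => w gap _ [<-].
pose s' := s + e / 2.
have s'0 : 0 <= s' by rewrite addr_ge0// divr_ge0// ltW.
have L1_const : {ae P, forall w, setT w -> (L1 s' w)%:E = (L1 s w)%:E}.
  apply: filterS2 rat_gap sol1 => w gap [_ sol] _; congr EFin.
  apply: (skorokhod_regulator_const sol) => // [|v /andP[sv vs']].
    by rewrite lerDl divr_ge0// ltW.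
  have v0 : 0 <= v by rewrite (le_trans s0)// ltW.
  have gap_v : 0 < b2 v - b1 v.
    by apply: gap_pos; [exact: ltW|rewrite /s' in vs'; lra].
  (* If [X1 v <= 0], right-continuity keeps [X1] below half of the gap at [v], and the gap above it,
     just after [v]; a rational time there contradicts [rat_gap]. *)
  rewrite ltNge; apply/negP => Xv.
  have : \forall r \near v^'+, X1 r w < b2 r - b1 r.
    near=> r; apply: (@lt_trans _ _ ((b2 v - b1 v) / 2)); near: r.
      by apply: (cvgr_lt _ ((skorokhod_x_cadlag sol).1 _ v0)); lra.
    by apply: (cvgr_gt _ (gap_cvg _ v0)); lra.
  case=> r /= r0 lt_gap.
  have /rat_in_itvoo[q] : v < v + r by rewrite ltrDl.
  rewrite in_itv/= => /andP[vq qr].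
  have := gap (pickle q) q (pickleK q) (le_lt_trans v0 vq).
  rewrite leNgt lt_gap//= /ball/= distrC ger0_norm ?subr_ge0 ?ltW//.
  by rewrite ltrBlDl.
have : ('E_P[L1 s'] = 'E_P[L1 s])%E.
  by rewrite !expectation_def; apply: ae_eq_integral => //; exact/measurable_EFinP.
rewrite !EL1// => -[] /(mulfI (lt0r_neq0 gamma_gt0)).
by rewrite /s'; lra.
Unshelve. all: by end_near. Qed.

End comparison.

Theorem proposition1p2 (R : realType) (d : measure_display)
  (T : measurableType d) (P : probability T R)
  (gamma : R) (gamma_gt0 : 0 < gamma)
  (W : R -> {RV P >-> R}) (W_brownian : standard_brownian_motion W)
  (xi : {RV P >-> R})
  (xi_indep : independent_of_process P xi (fun t => W t : T -> R))
  (supp_ge0 : measure_support (distribution P xi) `<=` `[0, +oo[)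
  (supp_0 : measure_support (distribution P xi) 0)
  (b1 b2 : R -> R)
  (b1_continuous : {within `[0, +oo[, continuous b1})
  (b2_continuous : {within `[0, +oo[, continuous b2})
  (b1_linear : linear_expected_regulator gamma W xi b1)
  (b2_linear : linear_expected_regulator gamma W xi b2) :
  forall t : R, 0 <= t -> b1 t = b2 t.
Proof.
move=> t t0.
have W_indep := brownian_increments_independent W_brownian.
have [X1 [L1 [sol1 EL1]]] := b1_linear.
have [X2 [L2 [sol2 EL2]]] := b2_linear.
have {}sol1 : {ae P, forall w, solution_path W xi b1 X1 L1 w}.
  by apply: filterS2 (brownian_0 W_brownian) sol1 => w; split.
have {}sol2 : {ae P, forall w, solution_path W xi b2 X2 L2 w}.
  by apply: filterS2 (brownian_0 W_brownian) sol2 => w; split.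
apply/eqP; rewrite eq_le; apply/andP; split.
  exact: (barrier_le W_indep xi_indep gamma_gt0 sol2 sol1 EL2 EL1).
exact: (barrier_le W_indep xi_indep gamma_gt0 sol1 sol2 EL1 EL2).
Qed.
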